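(* Let $n,m\ge1$ be integers. Then, as formal power series in $t,q$, $$\sum_{\pi\in\mathrm{PP}(\infty,n,m)}t^{\mathrm{des}(\pi)}q^{|\pi|_{uh}}=\prod_{i=1}^{m}\prod_{j=1}^{n}\frac{1}{1-t\,q^{i+j-1}}.$$
   Context: A plane partition $\pi=(\pi_{ij})_{i,j\ge1}$ is a two-dimensional array of nonnegative integers with finitely many nonzero entries such that $\pi_{ij}\ge\pi_{i+1\,j}$ and $\pi_{ij}\ge\pi_{i\,j+1}$ for all $i,j$ ($i$ is the row index, $j$ the column index). $\mathrm{PP}(\infty,n,m)$ is the set of plane partitions with at most $n$ nonzero rows and all entries at most $m$ (the number of columns is not restricted). The descent set is $\mathrm{Des}(\pi)=\{(i,j):\pi_{ij}>\pi_{i+1\,j}\}$ and $\mathrm{des}(\pi)=|\mathrm{Des}(\pi)|$. The up-hook of a cell is $\mathrm{uh}(i,j)=\pi_{ij}+i-1$ and the up-hook volume of $\pi$ is $|\pi|_{uh}=\sum_{(i,j)\in\mathrm{Des}(\pi)}\mathrm{uh}(i,j)$. *)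

(* Defs.v *)
From HB Require Import structures.
From mathcomp Require Import all_boot all_order all_algebra.
From mathcomp Require Import finmap.
From mathcomp Require Import boolp classical_sets functions cardinality fsbigop.
Set Implicit Arguments.
Unset Strict Implicit.
Unset Printing Implicit Defensive.
Import GRing.Theory.
Local Open Scope classical_set_scope.
Local Open Scope card_scope.
Local Open Scope ring_scope.

(* Formal power series in one variable. The ring R[[q]][[t]] is
   [fps (fps R)]: the coefficient of t^a q^b in F is [F a b]. *)

Record fps (R : Type) := Fps { fps_coef :> nat -> R }.

HB.instance Definition _ (R : Type) := gen_eqMixin (fps R).
HB.instance Definition _ (R : Type) := gen_choiceMixin (fps R).

Lemma fpsP (R : Type) (f g : fps R) : (forall n, f n = g n) -> f = g.
Proof. by case: f g => [f] [g] /= fg; congr Fps; apply/funext. Qed.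

Section FpsZmod.
Variable R : zmodType.
Implicit Types f g h : fps R.

Definition fps0 : fps R := Fps (fun=> 0).
Definition fps_opp f : fps R := Fps (fun n => - f n).
Definition fps_add f g : fps R := Fps (fun n => f n + g n).

Fact fps_addA : associative fps_add.
Proof. by move=> f g h; apply/fpsP => n /=; rewrite addrA. Qed.
Fact fps_addC : commutative fps_add.
Proof. by move=> f g; apply/fpsP => n /=; rewrite addrC. Qed.
Fact fps_add0 : left_id fps0 fps_add.
Proof. by move=> f; apply/fpsP => n /=; rewrite add0r. Qed.
Fact fps_addN : left_inverse fps0 fps_opp fps_add.
Proof. by move=> f; apply/fpsP => n /=; rewrite addNr. Qed.

HB.instance Definition _ :=
  GRing.isZmodule.Build (fps R) fps_addA fps_addC fps_add0 fps_addN.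
End FpsZmod.

Section FpsRing.
Variable R : comNzRingType.
Implicit Types f g h : fps R.

Definition fps1 : fps R := Fps (fun n => (n == 0%N)%:R).
Definition fps_mul f g : fps R :=
  Fps (fun n => \sum_(i < n.+1) f i * g (n - i)%N).

Let trunc N f : {poly R} := \poly_(i < N.+1) f i.

Let coef_trunc N f n : (n <= N)%N -> (trunc N f)`_n = f n.
Proof. by move=> nN; rewrite coef_poly ltnS nN. Qed.

Let coef_trunc_mul N f g n :
  (n <= N)%N -> fps_mul f g n = (trunc N f * trunc N g)`_n.
Proof.
move=> nN; rewrite coefM; apply: eq_bigr => i _.
rewrite !coef_trunc //; first exact: leq_trans (leq_subr _ _) nN.
by rewrite (leq_trans _ nN)// -ltnS.
Qed.

Fact fps_mulC : commutative fps_mul.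
Proof.
by move=> f g; apply/fpsP => n; rewrite !(coef_trunc_mul _ _ (leqnn n)) mulrC.
Qed.

Fact fps_mulA : associative fps_mul.
Proof.
move=> f g h; apply/fpsP => n.
transitivity ((trunc n f * (trunc n g * trunc n h))`_n).
  rewrite coefM; apply: eq_bigr => i _.
  rewrite coef_trunc; last by rewrite -ltnS.
  by rewrite (@coef_trunc_mul n) // leq_subr.
rewrite mulrA coefM; apply: eq_bigr => i _.
rewrite (@coef_trunc_mul n); last by rewrite -ltnS.
by rewrite coef_trunc // leq_subr.
Qed.

Fact fps_mul1 : left_id fps1 fps_mul.
Proof.
move=> f; apply/fpsP => n /=; rewrite big_ord_recl /= mul1r subn0 big1 ?addr0//.
by move=> i _; rewrite mul0r.
Qed.

Fact fps_mulDl : left_distributive fps_mul +%R.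
Proof.
move=> f g h; apply/fpsP => n /=; rewrite -big_split /=.
by apply: eq_bigr => i _; rewrite mulrDl.
Qed.

Fact fps_oner_neq0 : fps1 != 0.
Proof.
apply/eqP => /(congr1 (fun f : fps R => f 0%N)) /eqP /=.
by rewrite oner_eq0.
Qed.

HB.instance Definition _ := GRing.Zmodule_isComNzRing.Build (fps R)
  fps_mulA fps_mulC fps_mul1 fps_mulDl fps_oner_neq0.

Definition fpsC (c : R) : fps R := Fps (fun n => if n == 0%N then c else 0).
Definition fpsX : fps R := Fps (fun n => (n == 1%N)%:R).
End FpsRing.

Section FpsUnitRing.
Variable R : comUnitRingType.
Implicit Types f g : fps R.

Definition fps_unit : {pred fps R} := fun f => f 0%N \is a GRing.unit.

(* The first n.+1 coefficients of f^-1, by the usual recurrence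
   b_0 = a_0^-1 and b_(n+1) = - a_0^-1 * (a_1 b_n + ... + a_(n+1) b_0). *)
Fixpoint fps_inv_seq f n : seq R :=
  if n is n'.+1 then
    let s := fps_inv_seq f n' in
    rcons s (- (f 0%N)^-1 * \sum_(i < n'.+1) f i.+1 * s`_(n' - i))
  else [:: (f 0%N)^-1].

(* As everywhere in the algebraic hierarchy, f^-1 = f when f is not a unit. *)
Definition fps_inv f : fps R :=
  if f 0%N \is a GRing.unit then Fps (fun n => (fps_inv_seq f n)`_n) else f.

Let size_inv_seq f n : size (fps_inv_seq f n) = n.+1.
Proof. by elim: n => //= n IH; rewrite size_rcons IH. Qed.

Let nth_inv_seq f n k :
  (k <= n)%N -> (fps_inv_seq f n)`_k = (fps_inv_seq f k)`_k.
Proof.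
elim: n => [|n IH]; first by case: k.
rewrite leq_eqVlt => /predU1P[->//|]; rewrite ltnS => kn.
by rewrite /= nth_rcons size_inv_seq ltnS kn IH.
Qed.

Fact fps_mulVx : {in fps_unit, left_inverse 1 fps_inv *%R}.
Proof.
move=> f Uf; rewrite mulrC /fps_inv ifT//; apply/fpsP => -[|n].
  by rewrite /= big_ord_recl big_ord0 addr0 /= divrr.
rewrite [LHS]/= big_ord_recl subn0 /= nth_rcons size_inv_seq ltnn eqxx.
rewrite mulNr mulrN mulrA divrr // mul1r; apply/eqP; rewrite addrC subr_eq0.
apply/eqP/eq_bigr => i _; rewrite /bump leq0n add1n subSS.
by rewrite (@nth_inv_seq f n) ?leq_subr.
Qed.

Fact fps_unitPl f g : g * f = 1 -> fps_unit f.
Proof.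
move=> /(congr1 (fun h : fps R => h 0%N)).
rewrite /= big_ord_recl big_ord0 addr0 /= => gf1.
by apply/unitrPr; exists (g 0%N); rewrite mulrC.
Qed.

Fact fps_inv_out : {in [predC fps_unit], fps_inv =1 id}.
Proof. by move=> f; rewrite inE /fps_inv => /negbTE Uf; rewrite ifF. Qed.

HB.instance Definition _ := GRing.ComNzRing_hasMulInverse.Build (fps R)
  fps_mulVx fps_unitPl fps_inv_out.
End FpsUnitRing.

Definition fps_t : fps (fps int) := fpsX (fps int).
Definition fps_q : fps (fps int) := fpsC (fpsX int).

(* The possibly infinite family (f i), i in A, is summable with sum F: each
   monomial t^a q^b occurs in finitely many members, and its coefficients add
   up to the one in F. *)
Definition fps_has_sum (I : choiceType) (A : set I) (f : I -> fps (fps int))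
    (F : fps (fps int)) : Prop :=
  forall a b : nat, finite_set [set i | A i /\ f i a b != 0] /\
    \sum_(i \in A) f i a b = F a b.

(* Cells (i, j) are indexed from 0 here: [pi i j] is the entry in row i + 1 and
   column j + 1. *)

Definition plane_partition (pi : nat -> nat -> nat) : Prop :=
  [/\ finite_set [set c : nat * nat | pi c.1 c.2 != 0%N],
      forall i j, (pi i.+1 j <= pi i j)%N &
      forall i j, (pi i j.+1 <= pi i j)%N].

Definition PP (n m : nat) : set (nat -> nat -> nat) :=
  [set pi | [/\ plane_partition pi,
     [set i | exists j, pi i j != 0%N] #<= `I_n &
     forall i j, (pi i j <= m)%N]].

Definition Des (pi : nat -> nat -> nat) : set (nat * nat) :=
  [set c | (pi c.1.+1 c.2 < pi c.1 c.2)%N].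

(* Junk value 0 for [des] and [uh_volume] if [Des pi] is infinite, which does
   not happen for a plane partition. *)
Definition des (pi : nat -> nat -> nat) : nat :=
  (#|` fset_set (Des pi)|)%fset.

(* The hook value is pi_ij + i - 1 for a row index i starting from 1. *)
Definition uh (pi : nat -> nat -> nat) (c : nat * nat) : nat :=
  (pi c.1 c.2 + c.1)%N.

Definition uh_volume (pi : nat -> nat -> nat) : nat :=
  (\sum_(c \in Des pi) uh pi c)%R.

(* Main.v *)
(** Write [G i v] for the number of columns [j] with [pi i j > v], so that the rows of
    [G] and of [pi] are conjugate partitions.  In row [i], the columns [j] with
    [pi i j = v + 1 > pi (i + 1) j] are those with
    [max (G (i + 1) v) (G i (v + 1)) <= j < G i v]; let [M i v] be their number.  The
    resulting recursion for [G] is that of last-passage percolation with weights [M],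
    so [pi |-> M] is a bijection from [PP n m] onto the matrices of natural numbers
    supported in the [n] by [m] box.  Each of the [M i v] descents has up-hook
    [i + v + 1], so the series is a product of geometric series over the cells of the
    box. *)

Require Import Defs.
From mathcomp Require Import all_boot all_order all_algebra.
From mathcomp Require Import boolp classical_sets functions cardinality fsbigop.
From mathcomp Require Import zify.
Import GRing.Theory.
Local Open Scope classical_set_scope.
Local Open Scope card_scope.
Local Open Scope nat_scope.

(** * Counting in nonincreasing sequences *)

(** Since [f] is nonincreasing, the [k] with [v < f k] form an initial segment, which contains [j]
    exactly when it has more than [j] elements. *)
Lemma ltn_sum_gt (L : nat) (f : nat -> nat) (v j : nat) :
    (forall k, f k.+1 <= f k) -> (forall k, L <= k -> f k = 0) ->
  (j < \sum_(k < L) (v < f k)) = (v < f j).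
Proof.
elim: L f j => [|L IH] f j fS f0; first by rewrite big_ord0 f0.
have mono k : f k <= f 0 by elim: k => // k /(leq_trans (fS k)).
rewrite big_ord_recl; case: (ltnP v (f 0)) => vf0; last first.
  rewrite big1 => [|k _]; last by have := mono (lift ord0 k); case: ltnP => //; lia.
  by have := mono j; lia.
case: j => [|j]; first by rewrite vf0; lia.
rewrite add1n ltnS; apply: (IH (f \o succn)) => [k|k Lk] /=; first exact: fS.
by rewrite f0.
Qed.

Lemma eq_ltn_gt (a b : nat) : (forall v, (v < a) = (v < b)) -> a = b.
Proof. by move=> ab; have := ab a; have := ab b; rewrite !ltnn; lia. Qed.

Lemma sum_itv (L a b : nat) : \sum_(j < L) (a <= j < b) = minn L b - a.
Proof.
by elim: L => [|L IH]; rewrite ?big_ord0 ?min0n // big_ord_recr /= IH; case: andP; lia.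
Qed.

(** Conjugation of every row, as an equivalence in which [pi] and [G] play symmetric roles. *)
Definition transposed (pi G : nat -> nat -> nat) : Prop :=
  forall i j v, (v < pi i j) = (j < G i v).

Definition box_support (n m : nat) (M : nat -> nat -> nat) : Prop :=
  forall i v, (n <= i) || (m <= v) -> M i v = 0.

Definition corners (G : nat -> nat -> nat) (i v : nat) : nat :=
  G i v - maxn (G i.+1 v) (G i v.+1).

(* The fuel [k] makes the recursion structural; [n + m] steps leave the box from
   any cell. *)
Fixpoint lpp_rec (M : nat -> nat -> nat) (k i v : nat) : nat :=
  if k is k'.+1 then
    M i v + maxn (lpp_rec M k' i.+1 v) (lpp_rec M k' i v.+1)
  else 0.

(** * The last-passage recursion *)

Section LastPassage.
Variables (n m : nat).
Implicit Types M : nat -> nat -> nat.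

Definition lpp M : nat -> nat -> nat := lpp_rec M (n + m).

Lemma lpp_rec_support M k : box_support n m M -> box_support n m (lpp_rec M k).
Proof. by move=> M0; elim: k => //= k IH i v ?; rewrite M0 // !IH //; lia. Qed.

(** A cell with [n + m <= i + v] lies outside the box, where everything vanishes, so fuel beyond
    [n + m - (i + v)] changes nothing. *)
Lemma lpp_recE M k i v : box_support n m M -> n + m <= i + v + k ->
  lpp_rec M k.+1 i v = lpp_rec M k i v.
Proof.
move=> M0; elim: k i v => [|k IH] i v le /=; first by rewrite M0 //; lia.
by congr (_ + maxn _ _); apply: IH; lia.
Qed.

Lemma lppE M i v : box_support n m M ->
  lpp M i v = M i v + maxn (lpp M i.+1 v) (lpp M i v.+1).
Proof. by move=> M0; rewrite /lpp -{1}lpp_recE //; lia. Qed.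

Lemma lpp_support M : box_support n m M -> box_support n m (lpp M).
Proof. exact: lpp_rec_support. Qed.

(** Downward induction on [i + v]: each cell is fixed by its two successors, starting from zeros
    outside the box. *)
Lemma lpp_unique M G : box_support n m M -> box_support n m G ->
    (forall i v, G i v = M i v + maxn (G i.+1 v) (G i v.+1)) ->
  forall i v, G i v = lpp M i v.
Proof.
move=> M0 G0 GE; have MG0 := @lpp_support M M0.
suff H k i v : n + m <= i + v + k -> G i v = lpp M i v.
  by move=> i v; apply: (H (n + m)); lia.
elim: k i v => [|k IH] i v le; first by rewrite G0 ?MG0 //; lia.
by rewrite GE lppE // !IH //; lia.
Qed.

Lemma corners_lpp M i v : box_support n m M -> corners (lpp M) i v = M i v.
Proof. by move=> M0; rewrite /corners lppE // addnK. Qed.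

(** Monotonicity in both indices makes the truncated subtraction in [corners] exact. *)
Lemma lpp_corners G : box_support n m G ->
    (forall i v, G i.+1 v <= G i v) -> (forall i v, G i v.+1 <= G i v) ->
  forall i v, G i v = lpp (corners G) i v.
Proof.
move=> G0 Gi Gv; apply: lpp_unique => // i v.
  by move/G0=> Giv; rewrite /corners Giv.
by rewrite /corners; have := Gi i v; have := Gv i v; lia.
Qed.

(** * The bijection with plane partitions *)

Definition pp_of M (i j : nat) : nat := \sum_(v < m) (j < lpp M i v).

Lemma pp_ofP M : box_support n m M -> transposed (pp_of M) (lpp M).
Proof.
move=> M0 i j v; apply: (@ltn_sum_gt m (lpp M i) j v) => [k|k mk].
  by rewrite (lppE M i k) //; lia.
by rewrite lpp_support // mk orbT.
Qed.

Lemma transposed_finite pi G L : transposed pi G -> box_support n m G ->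
    (forall i v, G i v <= L) ->
  forall i j, (n <= i) || (L <= j) -> pi i j = 0.
Proof.
move=> piG G0 GL i j ij; apply/eqP; rewrite -leqn0 leqNgt piG -leqNgt.
by have := GL i 0; have := G0 i 0; lia.
Qed.

Lemma lpp_le M i v : box_support n m M -> lpp M i v <= lpp M 0 0.
Proof.
move=> M0; apply: (@leq_trans (lpp M i 0)).
  by elim: v => // v; apply: leq_trans; rewrite (lppE M i v) //; lia.
by elim: i => // i; apply: leq_trans; rewrite (lppE M i 0) //; lia.
Qed.

Lemma pp_of_PP M : box_support n m M -> PP n m (pp_of M).
Proof.
move=> M0; have T := pp_ofP M M0.
have fin := transposed_finite _ _ (lpp M 0 0) T (lpp_support M M0)
  (fun i v => lpp_le M i v M0).
split; first split.
- apply: (@sub_finite_set _ _ (`I_n `*` `I_(lpp M 0 0))).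
    move=> [i j] /= /eqP nz; split; rewrite /= ltnNge; apply/negP => le;
    by case: nz; rewrite fin // le ?orbT.
  by apply: finite_setX; apply: finite_II.
(* With [v := pp_of M i j], [T] gives [lpp M i v <= j]; both monotonicity claims follow from this
   bound. *)
- move=> i j; rewrite leqNgt T -leqNgt leqNgt.
  have := T i j (pp_of M i j); rewrite ltnn => /esym/negbT; rewrite (lppE M i) //; lia.
- move=> i j; rewrite leqNgt T -leqNgt.
  by have := T i j (pp_of M i j); rewrite ltnn => /esym/negbT; lia.
- apply: subset_card_le => i /= [j nz]; rewrite ltnNge; apply/negP => le.
  by move: nz; rewrite fin // le.
- by move=> i j; rewrite leqNgt T -leqNgt lpp_support // leqnn orbT.
Qed.

(** [pp_of M] determines [lpp M] by conjugation, and [corners] recovers [M] from it. *)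
Lemma pp_of_inj M M' : box_support n m M -> box_support n m M' ->
  pp_of M = pp_of M' -> forall i v, M i v = M' i v.
Proof.
move=> M0 M'0 E.
have lE i v : lpp M i v = lpp M' i v.
  by apply: eq_ltn_gt => j; rewrite -!pp_ofP // E.
by move=> i v; rewrite -corners_lpp // -(corners_lpp M') // /corners !lE.
Qed.

(** Columns are nonincreasing, so a nonzero entry in row [i] makes all rows [0] to [i] nonzero; for
    [n <= i] these are more than [n] rows. *)
Lemma PP_row0 pi i j : PP n m pi -> n <= i -> pi i j = 0.
Proof.
case=> -[_ Hi _] card _ ni; apply/eqP/negPn/negP => nz.
suff : `I_i.+1 #<= `I_n by rewrite card_le_II; lia.
apply: card_le_trans card; apply: subset_card_le => k /= ki; exists j.
apply: contra_neq nz => k0; apply/eqP; rewrite -leqn0 -k0.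
rewrite ltnS in ki; rewrite -(subnK ki); elim: (i - k) => // d.
by apply: leq_trans; rewrite addSn.
Qed.

Lemma PP_col0 pi : PP n m pi -> exists L, forall i j, L <= j -> pi i j = 0.
Proof.
case=> -[/finite_seqP [X XE] Hi _] _ _.
exists (\max_(c <- X) c.2.+1) => i j; apply: contraTeq => nz.
have : (i, j) \in X.
  by have : [set` X] (i, j); [rewrite -XE|].
rewrite -ltnNge => cX.
exact: (@leq_bigmax_seq _ X xpredT (fun c => c.2.+1) (i, j) cX isT).
Qed.

Lemma pp_of_surj pi : PP n m pi -> exists2 M, box_support n m M & pi = pp_of M.
Proof.
move=> piP; have [L piL] := PP_col0 _ piP; have pi0 := PP_row0 _ _ _ piP.
have [[_ Hi Hj] _ Hm] := piP.
(* The conjugate of [pi], counted over the finitely many columns that can be nonzero; its [corners]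
   give the preimage. *)
pose G i v := \sum_(j < L) (v < pi i j).
have T : transposed pi G by move=> i j v; rewrite (ltn_sum_gt L (pi i)) //; exact: piL.
have G0 : box_support n m G.
  move=> i v iv; apply: big1 => j _; have := Hm i j; have := pi0 i j.
  by case: ltnP => //; lia.
have GE := lpp_corners G G0.
have C0 : box_support n m (corners G) by move=> i v /G0 Giv; rewrite /corners Giv.
exists (corners G) => //; apply/funext => i; apply/funext => j.
apply: eq_ltn_gt => v; rewrite pp_ofP // T -GE // => k u; apply: leq_sum => l _.
- by have := Hi k l; case: ltnP; case: ltnP; lia.
- by case: ltnP; case: ltnP; lia.
Qed.

(** * Descents counted through corners *)

(** The weight [h] is arbitrary so that [des] and [uh_volume] come from one count: in row [i], the
    descents of value [v + 1] fill an interval of [corners G i v] columns. *)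
Lemma sum_Des pi G (h : nat -> nat -> nat) :
    transposed pi G -> box_support n m G ->
    (forall i v, G i.+1 v <= G i v) -> (forall i v, G i v.+1 <= G i v) ->
  finite_set (Des pi) /\
  (\sum_(c \in Des pi) h c.1 (pi c.1 c.2))%R =
  \sum_(i < n) \sum_(v < m) corners G i v * h i v.+1.
Proof.
move=> T G0 Gi Gv; set L := G 0 0.
have GL i v : G i v <= L.
  apply: (@leq_trans (G i 0)); first by elim: v => // v; apply: leq_trans.
  by rewrite /L; elim: i => // i; apply: leq_trans.
have fin := transposed_finite _ _ L T G0 GL.
pose r := [seq (i, j) | i <- iota 0 n, j <- iota 0 L].
have Ur : uniq r by apply: allpairs_uniq; rewrite ?iota_uniq // => -[? ?] [? ?].
have Dr : Des pi `<=` [set` r].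
  move=> [i j] /= D; apply/allpairsP; exists (i, j); rewrite !mem_iota /=.
  by split=> //; move: D (fin i j); rewrite /Des /=; lia.
have DE c : (c \in Des pi) = (pi c.1.+1 c.2 < pi c.1 c.2).
  by apply/idP/idP => [/set_mem|?]; [|apply/mem_set].
split; first exact: sub_finite_set Dr (finite_seq r).
transitivity (\sum_(c <- r) if c \in Des pi then h c.1 (pi c.1 c.2) else 0).
  rewrite [RHS](@fsbig_seq _ _ addn) // -fsbig_mkcondr; apply: eq_fsbigl.
  by apply/esym/setIidPr.
have iotaE k (F : nat -> nat) : \sum_(i <- iota 0 k) F i = \sum_(i < k) F i.
  by rewrite -(big_mkord xpredT) /index_iota subn0.
rewrite big_allpairs iotaE; apply: eq_bigr => i _; rewrite iotaE.
have T' k u j : (G k u <= j) = (pi k j <= u) by rewrite leqNgt -T -leqNgt.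
(* Pairs [(j, v)] are counted in two ways: summing over [j] first gives interval lengths, summing
   over [v] first leaves at most one term per column. *)
transitivity (\sum_(j < L) \sum_(v < m)
    (maxn (G i.+1 v) (G i v.+1) <= j < G i v) * h i v.+1); last first.
  rewrite exchange_big; apply: eq_bigr => v _ /=.
  by rewrite -big_distrl /= sum_itv (minn_idPr (GL i v)).
apply: eq_bigr => j _; rewrite DE /=; case: ltnP => D; last first.
  rewrite big1 // => v _; case: andP => // -[]; rewrite geq_max => /andP[].
  by rewrite !T' -T; lia.
(* A descent in column [j] is met only by [v = pi i j - 1]. *)
have pij : (pi i j).-1 < m.
  rewrite ltnNge; apply/negP => mp; have := T i j (pi i j).-1.
  by rewrite G0 ?mp ?orbT //; lia.
rewrite (bigD1 (Ordinal pij)) //= big1 => [|v vp].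
  rewrite addn0 prednK ?(leq_ltn_trans _ D) // geq_max !T' -T.
  by case: andP; lia.
case: andP => // -[]; rewrite geq_max => /andP[].
rewrite !T' -T; move: vp; rewrite -val_eqE /=; lia.
Qed.
End LastPassage.

(** * The two statistics in terms of the matrix *)

Section Statistics.
Variables (n m : nat) (M : nat -> nat -> nat).
Hypothesis M0 : box_support n m M.

Let sum_Des_pp_of (h : nat -> nat -> nat) :
  finite_set (Des (pp_of n m M)) /\
  (\sum_(c \in Des (pp_of n m M)) h c.1 (pp_of n m M c.1 c.2))%R =
  \sum_(i < n) \sum_(v < m) M i v * h i v.+1.
Proof.
have [||fin ->] := sum_Des n m _ _ h (pp_ofP n m M M0) (lpp_support n m M M0).
- by move=> i v; rewrite (lppE n m M i v) //; lia.
- by move=> i v; rewrite (lppE n m M i v) //; lia.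
split=> //; apply: eq_bigr => i _; apply: eq_bigr => v _.
by rewrite corners_lpp.
Qed.

Lemma des_pp_of : des (pp_of n m M) = \sum_(i < n) \sum_(v < m) M i v.
Proof.
have [fin] := sum_Des_pp_of (fun _ _ => 1); rewrite fsbig_finite //= => sum1.
rewrite /des -sum1_size [LHS]sum1.
by apply: eq_bigr => i _; apply: eq_bigr => v _; rewrite muln1.
Qed.

Lemma uh_volume_pp_of :
  uh_volume (pp_of n m M) = \sum_(i < n) \sum_(v < m) M i v * (v.+1 + i).
Proof. exact: (sum_Des_pp_of (fun i p => p + i)).2. Qed.

End Statistics.

(** * Matrices with bounded entries as a finite type *)

Definition box_ext {n m a : nat} (f : {ffun 'I_n * 'I_m -> 'I_a.+1}) (i v : nat)
    : nat :=
  if (insub i, insub v) is (Some i', Some v') then f (i', v') else 0.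

Lemma box_ext_ord (n m a : nat) (f : {ffun 'I_n * 'I_m -> 'I_a.+1})
    (i : 'I_n) (v : 'I_m) : box_ext f i v = f (i, v).
Proof. by rewrite /box_ext !valK. Qed.

Lemma box_ext_support (n m a : nat) (f : {ffun 'I_n * 'I_m -> 'I_a.+1}) :
  box_support n m (box_ext f).
Proof.
move=> i v; rewrite /box_ext.
by case: insubP => [i' lt _|//]; case: insubP => [v' lt' _|//]; lia.
Qed.

Lemma box_ext_surj (n m a : nat) (M : nat -> nat -> nat) : box_support n m M ->
    (forall i v, M i v <= a) ->
  exists f : {ffun 'I_n * 'I_m -> 'I_a.+1}, M = box_ext f.
Proof.
move=> M0 Ma; exists [ffun c : 'I_n * 'I_m => inord (M c.1 c.2)].
apply/funext => i; apply/funext => v; rewrite /box_ext.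
case: insubP => [i' _ <-|ni]; last by rewrite M0 //; lia.
case: insubP => [v' _ <-|nv]; last by rewrite M0 //; lia.
by rewrite ffunE inordK // ltnS.
Qed.

Lemma pp_of_box_ext_inj (n m a : nat) :
  injective (fun f : {ffun 'I_n * 'I_m -> 'I_a.+1} => pp_of n m (box_ext f)).
Proof.
move=> f g /pp_of_inj fg; apply/ffunP => -[i v]; apply: val_inj => /=.
by rewrite -!box_ext_ord fg //; apply: box_ext_support.
Qed.

(** Each entry of the matrix is at most the sum of all entries, which is [des pi]. *)
Lemma pp_of_box_ext_surj (n m : nat) (pi : nat -> nat -> nat) : PP n m pi ->
  exists f : {ffun 'I_n * 'I_m -> 'I_(des pi).+1}, pi = pp_of n m (box_ext f).
Proof.
move=> /pp_of_surj [M M0 piM].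
have [i v|f Mf] := box_ext_surj n m (des pi) M M0; last by exists f; rewrite -Mf.
case: (boolP ((n <= i) || (m <= v))) => [/M0 -> //|].
rewrite negb_or -!ltnNge => /andP[ni mv].
rewrite piM des_pp_of // (bigD1 (Ordinal ni)) //= (bigD1 (Ordinal mv)) //=; lia.
Qed.

(** * Coefficients of power series and truncated geometric series *)

Local Open Scope ring_scope.

Lemma coef_fpsXM (R : comNzRingType) (f : fps R) (k : nat) :
  (fpsX R * f) k = if k is k'.+1 then f k' else 0.
Proof.
case: k => [|k]; first by rewrite /= big_ord1 mul0r.
rewrite /= 2!big_ord_recl /= mul0r add0r mul1r /bump /= subSS subn0 big1 ?addr0 //.
by move=> i _; rewrite mul0r.
Qed.

Lemma coef_fpsXn (R : comNzRingType) (n k : nat) :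
  (fpsX R ^+ n) k = (k == n)%:R.
Proof.
by elim: n k => [|n IH] [|k] //; rewrite exprS coef_fpsXM ?IH.
Qed.

Lemma coef_mul_fpsXn_lt (R : comNzRingType) (f : fps R) (n k : nat) :
  (k < n)%N -> (fpsX R ^+ n * f) k = 0.
Proof.
move=> kn; rewrite /= big1 // => i _.
by rewrite coef_fpsXn (_ : _ == _ = false) ?mul0r //; have := ltn_ord i; lia.
Qed.

Lemma coef_mul_fpsC (R : comNzRingType) (f : fps R) (c : R) (k : nat) :
  (f * fpsC c) k = f k * c.
Proof.
rewrite /= big_ord_recr /= subnn /= big1 ?add0r // => i _.
by rewrite (_ : _ == _ = false) ?mulr0 //; have := ltn_ord i; lia.
Qed.

Lemma fpsCX (R : comNzRingType) (c : R) (n : nat) : fpsC c ^+ n = fpsC (c ^+ n).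
Proof.
elim: n => [|n IH]; first by apply/fpsP => -[|k].
apply/fpsP => k; rewrite exprSr IH coef_mul_fpsC /=.
by case: k => [|k] /=; rewrite ?mul0r // exprSr.
Qed.

Lemma coef_tq (d u a b : nat) :
  (fps_t ^+ d * fps_q ^+ u) a b = ((a == d) && (b == u))%:R.
Proof.
rewrite fpsCX coef_mul_fpsC coef_fpsXn.
by case: (a == d); rewrite ?mul1r ?mul0r // coef_fpsXn.
Qed.

(** Congruence modulo the power [N + 1] of the variable. *)
Definition fps_eq_upto {R : Type} (N : nat) (f g : fps R) : Prop :=
  forall k, (k <= N)%N -> f k = g k.

Lemma fps_eq_upto_prod (R : comNzRingType) (N : nat) (I : Type) (r : seq I)
    (F G : I -> fps R) : (forall i, fps_eq_upto N (F i) (G i)) ->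
  fps_eq_upto N (\prod_(i <- r) F i) (\prod_(i <- r) G i).
Proof.
move=> FG; apply: big_ind2 => // f1 f2 g1 g2 f12 g12 k kN /=.
by apply: eq_bigr => i _; rewrite f12 ?g12 //; have := ltn_ord i; lia.
Qed.

(** With [x = fpsX R * f], the two sides differ by [x ^+ N.+1 * (1 - x)^-1], whose coefficients
    vanish up to degree [N]. *)
Lemma fps_geometric (R : comUnitRingType) (N : nat) (f : fps R) :
  fps_eq_upto N (1 - fpsX R * f)^-1 (\sum_(k < N.+1) (fpsX R * f) ^+ k).
Proof.
set x := fpsX R * f => k kN.
(* The constant coefficient is [1], so the inverse is a genuine one. *)
have Ux : 1 - x \is a GRing.unit.
  by rewrite /in_mem /= /fps_unit /= big_ord1 mul0r subr0 unitr1.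
have -> : \sum_(k < N.+1) x ^+ k = (1 - x)^-1 - x ^+ N.+1 * (1 - x)^-1.
  rewrite -[X in X - _]mul1r -mulrBl -opprB subrX1 -mulNr opprB.
  by rewrite mulrAC divrr // mul1r.
rewrite exprMn -mulrA; set g := f ^+ _ * _.
transitivity ((1 - x)^-1 k - (fpsX R ^+ N.+1 * g) k) => //.
by rewrite coef_mul_fpsXn_lt ?subr0.
Qed.

Lemma coef_fps_sum (R : zmodType) (I : Type) (r : seq I) (P : pred I)
    (F : I -> fps R) (k : nat) :
  (\sum_(i <- r | P i) F i) k = \sum_(i <- r | P i) F i k.
Proof. exact: (big_morph (fun f : fps R => f k)). Qed.

Theorem theorem6p2 (n m : nat) (hn : (1 <= n)%N) (hm : (1 <= m)%N) :
  fps_has_sum (PP n m)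
    (fun pi => fps_t ^+ des pi * fps_q ^+ uh_volume pi)
    (\prod_(1 <= i < m.+1) \prod_(1 <= j < n.+1)
       (1 - fps_t * fps_q ^+ (i + j - 1)%N)^-1).
Proof.
(* A plane partition contributing to [t^a] has [M i v <= a] for all cells, so only
   finitely many matrices matter. *)
move=> a b.
pose psi (f : {ffun 'I_n * 'I_m -> 'I_a.+1}) := pp_of n m (box_ext f).
have psi_surj pi : PP n m pi ->
    (fps_t ^+ des pi * fps_q ^+ uh_volume pi) a b != 0 -> range psi pi.
  rewrite coef_tq => /pp_of_box_ext_surj.
  case: (a =P des pi) => [<- [f ->] _|_ _]; last by rewrite eqxx.
  by exists f.
split.
  apply: (@sub_finite_set _ _ (range psi)); last exact/finite_image/finite_finset.
  by move=> pi [piP]; apply: psi_surj.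
(* Members outside the range of [psi] have coefficient [0] here, which leaves a finite sum over
   [f]. *)
rewrite -(@fsbig_widen _ _ _ _ (range psi)); last 2 first.
- by move=> _ [f _ <-]; apply: pp_of_PP; apply: box_ext_support.
- move=> pi [piP npsi]; apply/eqP/negPn/negP => /(psi_surj _ piP); exact: npsi.
rewrite fsbig_image; last by move=> f g _ _; apply: pp_of_box_ext_inj.
rewrite (fsbigE (index_enum _)) ?index_enum_uniq //; last first.
  by move=> f _; rewrite mem_index_enum.
under eq_bigl do rewrite in_setT.
(* Modulo [t^(a+1)] each factor can be cut to its first [a + 1] powers; [c.1] is the row and [c.2]
   the value minus one. *)
transitivity ((\prod_(c : 'I_n * 'I_m) \sum_(k < a.+1)
    (fps_t * fps_q ^+ (c.2.+1 + c.1)) ^+ k) a b); last first.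
  rewrite big_add1 /= big_mkord; under [in RHS]eq_bigr do rewrite big_add1 /= big_mkord.
  rewrite [in RHS]exchange_big pair_big /=; congr (fps_coef _ b).
  apply/esym; apply: fps_eq_upto_prod (leqnn a) => c.
  rewrite (_ : (_ + _ - 1 = c.2.+1 + c.1)%N); last by lia.
  exact: fps_geometric.
(* Expanding the product picks an exponent [f c <= a] for each cell, that is, a matrix. *)
rewrite bigA_distr_bigA !coef_fps_sum; apply: eq_bigr => f _.
rewrite des_pp_of ?uh_volume_pp_of; try exact: box_ext_support.
rewrite !pair_big !expr_sum -big_split /=.
congr (fps_coef (fps_coef _ a) b); apply: eq_bigr => -[i v] _ /=.
by rewrite box_ext_ord exprMn -exprM mulnC.
Qed.
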